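(* For $\alpha\in\mathbb{N}_0$ and $\lambda,\eta,\delta\in\mathbb{C}$, the following formula holds for all $n\in\mathbb{N}$: $$\frac{\partial}{\partial x_2}\,{}_{\mathfrak{B}}\mathcal{F}_n^{(\alpha)}(x_1,x_2;\lambda;\eta,\delta)={}_{\mathfrak{B}}\mathcal{F}_n^{(\alpha)}(x_1+1,x_2;\lambda;\eta,\delta)-{}_{\mathfrak{B}}\mathcal{F}_n^{(\alpha)}(x_1,x_2;\lambda;\eta,\delta).$$
   Context: $\mathbb{N}$ is the set of natural numbers, $\mathbb{N}_0$ the set of non-negative integers, $\mathbb{C}$ the set of complex numbers; $x_1,x_2$ are variables. For $\alpha\in\mathbb{N}_0$ and $\lambda,\eta,\delta\in\mathbb{C}$, the Bell based Apostol type polynomials ${}_{\mathfrak{B}}\mathcal{F}_n^{(\alpha)}(x_1,x_2;\lambda;\eta,\delta)$ of order $\alpha$ are defined by the generating function $$\sum_{n\ge 0}{}_{\mathfrak{B}}\mathcal{F}_n^{(\alpha)}(x_1,x_2;\lambda;\eta,\delta)\frac{t^n}{n!}=\left(\frac{2^{\eta}t^{\delta}}{\lambda e^{t}+1}\right)^{\alpha}e^{x_1t+x_2(e^t-1)},\qquad |t|<|\log(-\lambda)|.$$ *)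

(* Defs.v *)
From Stdlib Require Export Reals Factorial.
From Coquelicot Require Export Coquelicot.

Open Scope C_scope.

Definition Cexp (z : C) : C :=
  (exp (Re z) * cos (Im z), exp (Re z) * sin (Im z))%R.

(* Principal argument, with values in (-PI, PI] for z <> 0. *)
Definition Carg (z : C) : R :=
  if Rle_dec 0 (Im z) then acos (Re z / Cmod z) else (- acos (Re z / Cmod z))%R.

(* Principal logarithm; meaningful only for z <> 0. *)
Definition Clog (z : C) : C := (ln (Cmod z), Carg z).

(* Principal value of z^a; meaningful only for z <> 0. *)
Definition Ccpow (z a : C) : C := Cexp (a * Clog z).

(* |log(-lambda)|, the distance from 0 to the nearest zero of lambda e^t + 1.
   For lambda = 0 there is no zero.  For lambda = -1 the principal logarithm
   vanishes and the disc would be empty; as usual for Apostol type polynomials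
   the bound is then 2 pi, the modulus of the nearest zero other than t = 0. *)
Definition apostol_radius (lambda : C) : Rbar :=
  if Ceq_dec lambda 0 then p_infty
  else if Ceq_dec lambda (-1) then Finite (2 * PI)
  else Finite (Cmod (Clog (- lambda))).

Definition bell_apostol_gf (alpha : nat) (lambda eta delta x1 x2 t : C) : C :=
  (Ccpow 2 eta * Ccpow t delta / (lambda * Cexp t + 1)) ^ alpha
  * Cexp (x1 * t + x2 * (Cexp t - 1)).

(* [F n x1 x2] is the n-th Bell based Apostol type polynomial of order [alpha]
   when the generating function identity holds.  The point t = 0, where
   t^delta (and, for lambda = -1, the quotient) has to be read as a limit, is
   left out: the values at t <> 0 already determine the coefficients.  If the
   right-hand side has no power series expansion (for instance alpha = 1,
   delta = 1/2), no [F] satisfies this predicate. *)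
Definition is_bell_apostol (alpha : nat) (lambda eta delta : C)
    (F : nat -> C -> C -> C) : Prop :=
  forall x1 x2 t : C,
    t <> 0 ->
    Rbar_lt (Cmod t) (apostol_radius lambda) ->
    is_series (K := C_AbsRing) (V := C_NormedModule)
      (fun n : nat => F n x1 x2 * (t ^ n / INR (fact n)))
      (bell_apostol_gf alpha lambda eta delta x1 x2 t).

(* Main.v *)
Require Import Defs.
From Stdlib Require Import Lra Lia.

(** Formally, differentiating the generating function [G x1 x2 t] in [x2]
    multiplies it by [exp t - 1], and so does passing from [x1] to [x1 + 1] and
    subtracting.  To turn this into a statement about coefficients without
    exchanging a derivative with an infinite sum, the dependence on [x2] is
    expanded to finite order.

    Multiplication by [exp t - 1] is a forward difference in [x1], so
    [G x1 x2 t * (exp t - 1) ^ j] has as coefficients the [j]-th forward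
    differences of the [F n] in [x1] ([is_series_fdiff]).  Moreover
    [G x1 (x2 + w) t = G x1 x2 t * exp (w * (exp t - 1))], and replacing the last
    exponential by its Taylor polynomial of degree [m] costs [O(t ^ (m + 1))] as
    [t] decreases to [0] ([Cexp_taylor_remainder]), since [G x1 x2] is bounded
    there, being the sum of a power series ([power_series_bounded]).  A power
    series which is [O(t ^ (m + 1))] on the positive reals has vanishing
    coefficients up to order [m] ([power_series_coef_vanish]).  For [m > n] this
    gives the finite formula ([bell_apostol_taylor])
    [F n x1 (x2 + w) = sum_j w ^ j / j! * fdiff j F n (x1, x2)],
    whose linear coefficient in [w] is [F n (x1 + 1) x2 - F n x1 x2].

    Only small positive real [t] are used, and the prefactor of the generating
    function plays no role beyond being independent of [x1] and [x2]. *)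

(** * Power series in a small positive real variable *)

(** A bound on all partial sums passes to the sum of the series. *)
Lemma is_series_Cmod_le (a : nat -> C) (l : C) (B : R) :
  is_series (K := C_AbsRing) (V := C_NormedModule) a l ->
  (forall N, (Cmod (sum_n a N) <= B)%R) -> (Cmod l <= B)%R.
Proof.
  intros Ha HB.
  assert (Hl : is_lim_seq (fun N => Cmod (sum_n a N)) (Cmod l)).
  { exact (filterlim_comp _ _ _ _ _ _ _ _ Ha
             (filterlim_norm (V := C_NormedModule) l)). }
  exact (is_lim_seq_le _ _ _ _ HB Hl (is_lim_seq_const B)).
Qed.

Lemma sum_n_half_le (N : nat) : (sum_n (fun k => (/ 2) ^ k)%R N <= 2)%R.
Proof.
  assert (H : (sum_n (fun k => (/ 2) ^ k)%R N = 2 - (/ 2) ^ N)%R).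
  { induction N as [|N IH].
    - rewrite sum_O. simpl. lra.
    - rewrite sum_Sn, IH. unfold plus; simpl. lra. }
  rewrite H. pose proof (pow_lt (/ 2) N). lra.
Qed.

(** The sum of a power series converging on [(0, r)] is bounded near [0]: its
    terms are bounded at [r / 2], hence dominated by a geometric series of ratio
    [1 / 2] on [(0, r / 4)]. *)
Lemma power_series_bounded (b : nat -> C) (f : R -> C) (r : R) :
  (0 < r)%R ->
  (forall t, (0 < t < r)%R ->
     is_series (K := C_AbsRing) (V := C_NormedModule)
       (fun k => b k * RtoC t ^ k) (f t)) ->
  exists K d, (0 < d)%R /\ forall t, (0 < t < d)%R -> (Cmod (f t) <= K)%R.
Proof.
  intros Hr Hf.
  assert (H0 : (0 < r / 2 < r)%R) by lra.
  specialize (Hf (r / 2)%R H0) as Hs0.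
  (* The terms of a convergent series are differences of its bounded partial
     sums. *)
  destruct (filterlim_bounded (K := C_AbsRing) (V := C_NormedModule)
              (sum_n (fun k => b k * RtoC (r / 2) ^ k))
              (ex_intro _ _ Hs0)) as [M HM].
  assert (Hterm : forall k, (Cmod (b k) * (r / 2) ^ k <= 2 * M)%R).
  { intros k.
    assert (E : (Cmod (b k) * (r / 2) ^ k)%R = Cmod (b k * RtoC (r / 2) ^ k)).
    { rewrite Cmod_mult, Cmod_pow, Cmod_R, (Rabs_pos_eq (r / 2)); lra. }
    rewrite E. clear E.
    destruct k as [|k].
    - specialize (HM 0%nat). rewrite sum_O in HM.
      pose proof (norm_ge_0 (K := C_AbsRing) (V := C_NormedModule)
        (b 0%nat * RtoC (r / 2) ^ 0)) as Hp.
      change (Cmod (b 0%nat * RtoC (r / 2) ^ 0) <= M)%R in HM.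
      change (0 <= Cmod (b 0%nat * RtoC (r / 2) ^ 0))%R in Hp. lra.
    - pose proof (HM k) as H1. pose proof (HM (S k)) as H2.
      set (u := fun k : nat => b k * RtoC (r / 2) ^ k) in *.
      change (Cmod (sum_n u k) <= M)%R in H1.
      change (Cmod (sum_n u (S k)) <= M)%R in H2.
      change (Cmod (u (S k)) <= 2 * M)%R.
      assert (E : u (S k) = sum_n u (S k) + - sum_n u k).
      { rewrite sum_Sn. change plus with Cplus. ring. }
      rewrite E. eapply Rle_trans; [apply Cmod_triangle|].
      rewrite Cmod_opp. lra. }
  exists (2 * M * 2)%R, (r / 4)%R. split; [lra|].
  intros t Ht.
  apply is_series_Cmod_le with (1 := Hf t ltac:(lra)).
  intros N.
  assert (HM0 : (0 <= 2 * M)%R).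
  { specialize (Hterm 0%nat). pose proof (Cmod_ge_0 (b 0%nat)). simpl in Hterm. lra. }
  apply Rle_trans with (sum_n (fun k => 2 * M * (/ 2) ^ k)%R N).
  - eapply Rle_trans;
      [exact (norm_sum_n_m (K := C_AbsRing) (V := C_NormedModule) _ 0 N)|].
    apply sum_n_m_le. intros k.
    change (Cmod (b k * RtoC t ^ k) <= 2 * M * (/ 2) ^ k)%R.
    rewrite Cmod_mult, Cmod_pow, Cmod_R, (Rabs_pos_eq t) by lra.
    apply Rle_trans with (Cmod (b k) * ((r / 2) ^ k * (/ 2) ^ k))%R.
    + apply Rmult_le_compat_l; [apply Cmod_ge_0|].
      rewrite <- Rpow_mult_distr. apply pow_incr. lra.
    + rewrite <- Rmult_assoc. apply Rmult_le_compat_r; [|apply Hterm].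
      apply pow_le. lra.
  - rewrite (sum_n_mult_l (K := R_Ring) (2 * M)%R).
    apply (Rmult_le_compat_l (2 * M)); [lra|apply sum_n_half_le].
Qed.

(** Removing the constant term of a power series and dividing by [t]. *)
Lemma is_series_shift (b : nat -> C) (t l : C) :
  t <> 0 ->
  is_series (K := C_AbsRing) (V := C_NormedModule) (fun k => b k * t ^ k) l ->
  is_series (K := C_AbsRing) (V := C_NormedModule)
    (fun k => b (S k) * t ^ k) (/ t * (l - b 0%nat)).
Proof.
  intros Ht Hs.
  apply is_series_ext with (fun k => scal (/ t) (b (S k) * t ^ S k) : C_NormedModule).
  { intros k. change scal with Cmult. simpl. field. exact Ht. }
  apply (is_series_scal (K := C_AbsRing) (V := C_NormedModule) (/ t)).
  apply (is_series_incr_1 (K := C_AbsRing) (V := C_NormedModule)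
           (fun k => b k * t ^ k)).
  refine (eq_ind l _ Hs _ _).
  change plus with Cplus. simpl. ring.
Qed.

(** Uniqueness of power series coefficients, in truncated form: a power series
    which is [O(t ^ n)] on the right of [0] has its first [n] coefficients
    equal to [0]. *)
Lemma power_series_coef_vanish (n : nat) :
  forall (b : nat -> C) (f : R -> C) (r M : R),
  (0 < r)%R ->
  (forall t, (0 < t < r)%R ->
     is_series (K := C_AbsRing) (V := C_NormedModule)
       (fun k => b k * RtoC t ^ k) (f t)) ->
  (forall t, (0 < t < r)%R -> (Cmod (f t) <= M * t ^ n)%R) ->
  forall k, (k < n)%nat -> b k = 0.
Proof.
  induction n as [|n IH]; intros b f r M Hr Hf HM k Hk; [lia|].
  assert (Hg : forall t, (0 < t < r)%R ->
     is_series (K := C_AbsRing) (V := C_NormedModule)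
       (fun k => b (S k) * RtoC t ^ k) (/ RtoC t * (f t - b 0%nat))).
  { intros t Ht. apply is_series_shift; [|apply Hf, Ht].
    intros E. apply RtoC_inj in E. lra. }
  (* [f t = b 0 + O(t)] and [f t = O(t)] force [b 0 = 0]. *)
  assert (Hb0 : b 0%nat = 0).
  { destruct (power_series_bounded _ _ _ Hr Hg) as [K [d [Hd HK]]].
    apply Cmod_eq_0.
    apply Rle_antisym; [|apply Cmod_ge_0].
    apply Rnot_lt_le. intros Hpos.
    (* At the point [t] below, [Cmod (b 0) <= (Rabs M + Rabs K) * t] contradicts
       [t * B <= Cmod (b 0) / 2]. *)
    set (B := (Rabs M + Rabs K + 1)%R).
    assert (HB : (0 < B)%R)
      by (unfold B; pose proof (Rabs_pos M); pose proof (Rabs_pos K); lra).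
    set (t := (Rmin (Rmin (r / 2) (d / 2)) (Rmin 1 (Cmod (b 0%nat) / (2 * B))))%R).
    assert (Hq : (0 < Cmod (b 0%nat) / (2 * B))%R).
    { apply Rdiv_lt_0_compat; lra. }
    assert (Ht0 : (0 < t)%R).
    { unfold t. repeat apply Rmin_glb_lt; lra. }
    assert (Ht1 : (t <= r / 2 /\ t <= d / 2 /\ t <= 1
                   /\ t <= Cmod (b 0%nat) / (2 * B))%R).
    { unfold t.
      pose proof (Rmin_l (Rmin (r / 2) (d / 2)) (Rmin 1 (Cmod (b 0%nat) / (2 * B)))).
      pose proof (Rmin_r (Rmin (r / 2) (d / 2)) (Rmin 1 (Cmod (b 0%nat) / (2 * B)))).
      pose proof (Rmin_l (r / 2) (d / 2)). pose proof (Rmin_r (r / 2) (d / 2)).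
      pose proof (Rmin_l 1 (Cmod (b 0%nat) / (2 * B))).
      pose proof (Rmin_r 1 (Cmod (b 0%nat) / (2 * B))). repeat split; lra. }
    destruct Ht1 as [T1 [T2 [T3 T4]]].
    specialize (HM t ltac:(lra)). specialize (HK t ltac:(lra)).
    assert (Htn : (t ^ S n <= t)%R).
    { simpl. rewrite <- (Rmult_1_r t) at 3. apply Rmult_le_compat_l; [lra|].
      rewrite <- (pow1 n). apply pow_incr. lra. }
    assert (HtC : RtoC t <> 0) by (intros E; apply RtoC_inj in E; lra).
    assert (E : b 0%nat = f t + - (RtoC t * (/ RtoC t * (f t - b 0%nat)))).
    { field. exact HtC. }
    assert (Hle : (Cmod (b 0%nat) <= Rabs M * t + t * Rabs K)%R).
    { rewrite E. eapply Rle_trans; [apply Cmod_triangle|].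
      rewrite Cmod_opp, (Cmod_mult (RtoC t)), Cmod_R, (Rabs_pos_eq t) by lra.
      apply Rplus_le_compat.
      - eapply Rle_trans; [exact HM|].
        apply Rle_trans with (Rabs M * t ^ S n)%R.
        + apply Rmult_le_compat_r; [apply pow_le; lra|apply Rle_abs].
        + apply Rmult_le_compat_l; [apply Rabs_pos|exact Htn].
      - apply Rmult_le_compat_l; [lra|].
        eapply Rle_trans; [exact HK|apply Rle_abs]. }
    assert (HtB : (t * B <= Cmod (b 0%nat) / 2)%R).
    { apply Rle_trans with (Cmod (b 0%nat) / (2 * B) * B)%R.
      - apply Rmult_le_compat_r; lra.
      - right. field. lra. }
    unfold B in HtB. lra. }
  destruct k as [|k]; [exact Hb0|].
  apply (IH (fun k => b (S k)) _ r M Hr Hg); [|lia].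
  intros t Ht. rewrite Hb0, Cmod_mult.
  assert (HtC : RtoC t <> 0) by (intros E; apply RtoC_inj in E; lra).
  rewrite Cmod_inv, Cmod_R, (Rabs_pos_eq t) by (assumption || lra).
  replace (f t - 0) with (f t) by ring.
  specialize (HM t Ht). simpl in HM.
  apply Rmult_le_reg_l with t; [lra|].
  rewrite <- Rmult_assoc, Rinv_r, Rmult_1_l by lra. lra.
Qed.

(** * The complex exponential *)

Lemma Cexp_plus (u v : C) : Cexp (u + v) = Cexp u * Cexp v.
Proof.
  destruct u as [a b], v as [c d]. unfold Cexp, Cmult; simpl.
  rewrite exp_plus, cos_plus, sin_plus. f_equal; ring.
Qed.

Lemma Cexp_RtoC (t : R) : Cexp (RtoC t) = RtoC (exp t).
Proof.
  unfold Cexp; simpl. rewrite cos_0, sin_0.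
  apply injective_projections; simpl; ring.
Qed.

(** [is_derive_RC h s l]: the function [h] of a real variable has derivative [l]
    at [s], both components being differentiated separately. *)
Definition is_derive_RC (h : R -> C) (s : R) (l : C) : Prop :=
  is_derive (fun s => Re (h s)) s (Re l) /\ is_derive (fun s => Im (h s)) s (Im l).

Lemma is_derive_RC_minus (h k : R -> C) (s : R) (l m : C) :
  is_derive_RC h s l -> is_derive_RC k s m ->
  is_derive_RC (fun s => h s - k s) s (l - m).
Proof.
  intros [Hh1 Hh2] [Hk1 Hk2].
  split; [exact (is_derive_minus _ _ _ _ _ Hh1 Hk1)
         |exact (is_derive_minus _ _ _ _ _ Hh2 Hk2)].
Qed.

Lemma is_derive_RC_const (c : C) (s : R) : is_derive_RC (fun _ => c) s 0.
Proof. split; apply (is_derive_const (K := R_AbsRing) (V := R_NormedModule)). Qed.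

Lemma is_derive_RC_ext (h k : R -> C) (s : R) (l : C) :
  (forall s, h s = k s) -> is_derive_RC h s l -> is_derive_RC k s l.
Proof.
  intros E [H1 H2]. split.
  - apply is_derive_ext with (2 := H1). intros t. now rewrite E.
  - apply is_derive_ext with (2 := H2). intros t. now rewrite E.
Qed.

(** A function of a real variable vanishing at [0] whose derivative is
    [O(s ^ n)] is [O(s ^ (n + 1))]. *)
Lemma Cmod_le_of_derive (h dh : R -> C) (n : nat) (M : R) :
  (0 <= M)%R -> h 0%R = 0 ->
  (forall s, is_derive_RC h s (dh s)) ->
  (forall s, (Rabs s <= 1)%R -> (Cmod (dh s) <= M * Rabs s ^ n)%R) ->
  forall s, (Rabs s <= 1)%R -> (Cmod (h s) <= 2 * M * Rabs s ^ S n)%R.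
Proof.
  intros HM H0 Hd Hb s Hs.
  assert (Hloc : forall t, (Rabs (t - 0) <= Rabs (s - 0))%R ->
            (Cmod (dh t) <= M * Rabs s ^ n)%R).
  { intros t Ht. rewrite !Rminus_0_r in Ht.
    eapply Rle_trans; [apply Hb; lra|].
    apply Rmult_le_compat_l; [exact HM|].
    apply pow_incr. split; [apply Rabs_pos|exact Ht]. }
  assert (Hre : (Rabs (Re (h s) - Re (h 0%R)) <= M * Rabs s ^ n * Rabs (s - 0))%R).
  { apply (bounded_variation (fun s => Re (h s)) (fun s => Re (dh s))).
    intros t Ht. split; [apply Hd|].
    eapply Rle_trans; [|apply Hloc, Ht].
    eapply Rle_trans; [|apply Rmax_Cmod]. apply Rmax_l. }
  assert (Him : (Rabs (Im (h s) - Im (h 0%R)) <= M * Rabs s ^ n * Rabs (s - 0))%R).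
  { apply (bounded_variation (fun s => Im (h s)) (fun s => Im (dh s))).
    intros t Ht. split; [apply Hd|].
    eapply Rle_trans; [|apply Hloc, Ht].
    eapply Rle_trans; [|apply Rmax_Cmod]. apply Rmax_r. }
  rewrite H0 in Hre, Him. unfold Re, Im, RtoC in Hre, Him. simpl in Hre, Him.
  rewrite !Rminus_0_r in Hre, Him.
  assert (E : h s = RtoC (Re (h s)) + Ci * RtoC (Im (h s))).
  { destruct (h s) as [a b]. unfold Ci, RtoC, Cplus, Cmult, Re, Im; simpl.
    f_equal; ring. }
  rewrite E. eapply Rle_trans; [apply Cmod_triangle|].
  rewrite Cmod_mult, !Cmod_R.
  replace (Cmod Ci) with 1%R.
  2: { unfold Cmod, Ci; simpl. rewrite <- sqrt_1 at 1. f_equal. ring. }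
  simpl. unfold Re, Im. lra.
Qed.

(** Taylor polynomial of degree [n] of the exponential, evaluated at [w]. *)
Definition exp_taylor (w : C) (n : nat) : C :=
  sum_n (G := C_NormedModule) (fun j => w ^ j / INR (fact j)) n.

Lemma exp_taylor_S (w : C) (n : nat) :
  exp_taylor w (S n) = exp_taylor w n + w ^ S n / INR (fact (S n)).
Proof. unfold exp_taylor. rewrite sum_Sn. reflexivity. Qed.

Lemma INR_fact_C_neq_0 (n : nat) : RtoC (INR (fact n)) <> 0.
Proof.
  intros E. apply RtoC_inj in E. exact (INR_fact_neq_0 n E).
Qed.

Lemma is_derive_RC_monomial (w : C) (n : nat) (s : R) :
  is_derive_RC (fun s => (w * RtoC s) ^ S n / INR (fact (S n))) s
    (w * ((w * RtoC s) ^ n / INR (fact n))).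
Proof.
  set (c := w ^ S n / INR (fact (S n))).
  apply is_derive_RC_ext with (fun s => c * RtoC (s ^ S n)).
  { intros u. unfold c. rewrite Cpow_mult_l, RtoC_pow.
    field. apply INR_fact_C_neq_0. }
  replace (w * ((w * RtoC s) ^ n / INR (fact n)))
    with (c * RtoC (INR (S n) * s ^ n)).
  2: { unfold c. rewrite Cpow_mult_l, fact_simpl, mult_INR, !RtoC_mult, RtoC_pow.
    rewrite Cpow_S. field. split; [apply INR_fact_C_neq_0|].
    intros E. apply RtoC_inj in E. revert E. apply not_0_INR. lia. }
  clearbody c. split.
  - apply is_derive_ext with (fun s => Re c * s ^ S n)%R.
    { intros u. unfold Re; simpl. ring. }
    auto_derive; [exact I|]. unfold Re. simpl. ring.
  - apply is_derive_ext with (fun s => Im c * s ^ S n)%R.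
    { intros u. unfold Im; simpl. ring. }
    auto_derive; [exact I|]. unfold Im. simpl. ring.
Qed.

Lemma is_derive_RC_Cexp (w : C) (s : R) :
  is_derive_RC (fun s => Cexp (w * RtoC s)) s (w * Cexp (w * RtoC s)).
Proof.
  destruct w as [a b]. unfold is_derive_RC, Cexp, Re, Im; simpl. split.
  - auto_derive; [exact I|]. unfold Rminus. ring.
  - auto_derive; [exact I|]. unfold Rminus. ring.
Qed.

Lemma exp_taylor_0 (w : C) : exp_taylor w 0 = 1.
Proof.
  unfold exp_taylor. rewrite sum_O. simpl. field.
Qed.

Lemma is_derive_RC_Cexp_remainder_0 (w : C) (s : R) :
  is_derive_RC (fun s => Cexp (w * RtoC s) - exp_taylor (w * RtoC s) 0) s
    (w * Cexp (w * RtoC s)).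
Proof.
  apply is_derive_RC_ext with (fun s => Cexp (w * RtoC s) - 1).
  { intros u. now rewrite exp_taylor_0. }
  replace (w * Cexp (w * RtoC s)) with (w * Cexp (w * RtoC s) - 0) by ring.
  apply is_derive_RC_minus; [apply is_derive_RC_Cexp|apply is_derive_RC_const].
Qed.

(** The derivative of the remainder of order [n + 1] is [w] times the remainder of
    order [n]. *)
Lemma is_derive_RC_Cexp_remainder (w : C) (n : nat) (s : R) :
  is_derive_RC (fun s => Cexp (w * RtoC s) - exp_taylor (w * RtoC s) (S n)) s
    (w * (Cexp (w * RtoC s) - exp_taylor (w * RtoC s) n)).
Proof.
  induction n as [|n IH].
  - apply is_derive_RC_ext with (fun s =>
      Cexp (w * RtoC s) - exp_taylor (w * RtoC s) 0
      - (w * RtoC s) ^ 1 / INR (fact 1)).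
    { intros u. rewrite exp_taylor_S. ring. }
    replace (w * (Cexp (w * RtoC s) - exp_taylor (w * RtoC s) 0))
      with (w * Cexp (w * RtoC s) - w * ((w * RtoC s) ^ 0 / INR (fact 0))).
    2: { rewrite exp_taylor_0. simpl. field. }
    apply is_derive_RC_minus; [apply is_derive_RC_Cexp_remainder_0
                              |apply is_derive_RC_monomial].
  - apply is_derive_RC_ext with (fun s =>
      Cexp (w * RtoC s) - exp_taylor (w * RtoC s) (S n)
      - (w * RtoC s) ^ S (S n) / INR (fact (S (S n)))).
    { intros u. rewrite (exp_taylor_S _ (S n)). ring. }
    rewrite (exp_taylor_S _ n).
    replace (w * (Cexp (w * RtoC s)
                  - (exp_taylor (w * RtoC s) n
                     + (w * RtoC s) ^ S n / INR (fact (S n)))))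
      with (w * (Cexp (w * RtoC s) - exp_taylor (w * RtoC s) n)
            - w * ((w * RtoC s) ^ S n / INR (fact (S n)))) by ring.
    apply is_derive_RC_minus; [exact IH|apply is_derive_RC_monomial].
Qed.

Lemma Cexp_0 : Cexp 0 = 1.
Proof. rewrite Cexp_RtoC, exp_0. reflexivity. Qed.

Lemma Cexp_remainder_at_0 (w : C) (n : nat) :
  Cexp (w * RtoC 0) - exp_taylor (w * RtoC 0) n = 0.
Proof.
  replace (w * RtoC 0) with (RtoC 0) by ring. rewrite Cexp_0.
  induction n as [|n IH].
  - rewrite exp_taylor_0. ring.
  - rewrite exp_taylor_S, Cpow_S.
    replace (1 - (exp_taylor 0 n + 0 * 0 ^ n / INR (fact (S n))))
      with (1 - exp_taylor 0 n) by (field; apply INR_fact_C_neq_0).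
    exact IH.
Qed.

Lemma Cmod_Cexp (z : C) : Cmod (Cexp z) = exp (Re z).
Proof.
  unfold Cmod, Cexp; simpl.
  replace (_ + _)%R with (exp (Re z) ^ 2 * (Rsqr (sin (Im z)) + Rsqr (cos (Im z))))%R
    by (unfold Rsqr; ring).
  rewrite sin2_cos2, Rmult_1_r. apply sqrt_pow2. left. apply exp_pos.
Qed.

(** Taylor formula for the exponential, with the order of the remainder;
    the constant may depend on [w] and [n]. *)
Lemma Cexp_taylor_remainder (w : C) (n : nat) :
  exists M, (0 <= M)%R /\ forall s, (Rabs s <= 1)%R ->
    (Cmod (Cexp (w * RtoC s) - exp_taylor (w * RtoC s) n) <= M * Rabs s ^ S n)%R.
Proof.
  induction n as [|n [M [HM IH]]].
  - set (B := (Cmod w * exp (Cmod w))%R).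
    assert (HB : (0 <= B)%R).
    { apply Rmult_le_pos; [apply Cmod_ge_0|left; apply exp_pos]. }
    exists (2 * B)%R. split; [lra|].
    apply Cmod_le_of_derive with (dh := fun s => w * Cexp (w * RtoC s));
      [exact HB|apply Cexp_remainder_at_0|apply is_derive_RC_Cexp_remainder_0|].
    intros s Hs. rewrite pow_O, Rmult_1_r, Cmod_mult, Cmod_Cexp.
    apply Rmult_le_compat_l; [apply Cmod_ge_0|].
    assert (Hle : (Re (w * RtoC s) <= Cmod w)%R).
    { eapply Rle_trans; [apply Rle_abs|].
      eapply Rle_trans; [eapply Rle_trans; [apply Rmax_l|apply Rmax_Cmod]|].
      rewrite Cmod_mult, Cmod_R.
      rewrite <- (Rmult_1_r (Cmod w)) at 2.
      apply Rmult_le_compat_l; [apply Cmod_ge_0|exact Hs]. }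
    destruct Hle as [Hlt|Heq]; [left; now apply exp_increasing|right; now rewrite Heq].
  - exists (2 * (Cmod w * M))%R.
    assert (HB : (0 <= Cmod w * M)%R) by (apply Rmult_le_pos; [apply Cmod_ge_0|exact HM]).
    split; [lra|].
    apply Cmod_le_of_derive with
      (dh := fun s => w * (Cexp (w * RtoC s) - exp_taylor (w * RtoC s) n));
      [exact HB|apply Cexp_remainder_at_0|apply is_derive_RC_Cexp_remainder|].
    intros s Hs. rewrite Cmod_mult, Rmult_assoc.
    apply Rmult_le_compat_l; [apply Cmod_ge_0|exact (IH s Hs)].
Qed.

(** * Positivity of the radius *)

(** The radius vanishes only if [log (- lambda) = 0], that is [lambda = -1], for
    which the radius is [2 * PI] by convention. *)
Lemma apostol_radius_pos (lambda : C) : Rbar_lt 0 (apostol_radius lambda).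
Proof.
  unfold apostol_radius.
  destruct (Ceq_dec lambda 0) as [_|H0]; [exact I|].
  destruct (Ceq_dec lambda (-1)) as [_|H1].
  { simpl. pose proof PI_RGT_0. lra. }
  simpl. apply Cmod_gt_0. intros E. unfold Clog in E. injection E as Eln Earg.
  assert (Hn0 : - lambda <> 0).
  { intros E. apply H0. replace lambda with (- - lambda) by ring. rewrite E. ring. }
  pose proof (proj1 (Cmod_gt_0 _) Hn0) as Hpos.
  assert (Hmod : Cmod (- lambda) = 1%R).
  { rewrite <- (exp_ln _ Hpos), Eln. apply exp_0. }
  assert (Hacos : acos (Re (- lambda)) = 0%R).
  { unfold Carg in Earg. rewrite Hmod, Rdiv_1_r in Earg.
    destruct Rle_dec; lra. }
  assert (Hb : (-1 <= Re (- lambda) <= 1)%R).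
  { apply Rabs_le_between. rewrite <- Hmod.
    eapply Rle_trans; [|apply Rmax_Cmod]. apply Rmax_l. }
  assert (Hre : Re (- lambda) = 1%R).
  { rewrite <- (cos_acos _ Hb), Hacos. apply cos_0. }
  assert (Him : Im (- lambda) = 0%R).
  { unfold Cmod in Hmod. fold (Re (- lambda)) (Im (- lambda)) in Hmod.
    rewrite Hre in Hmod.
    assert (Hsq : (1 ^ 2 + Im (- lambda) ^ 2 = 1)%R).
    { rewrite <- (sqrt_sqrt (1 ^ 2 + Im (- lambda) ^ 2)), Hmod; [ring|].
      pose proof (pow2_ge_0 (Im (- lambda))). lra. }
    apply Rsqr_0_uniq. unfold Rsqr. lra. }
  apply H1. destruct lambda as [a b]. unfold Re, Im in Hre, Him. simpl in Hre, Him.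
  unfold RtoC, Copp; simpl. f_equal; lra.
Qed.

(** * Derivative of a polynomial at its centre *)

Lemma is_derive_of_quadratic_bound (f : C -> C) (x l : C) (K : R) :
  (forall y, (Cmod (y - x) <= 1)%R ->
     (Cmod (f y - f x - (y - x) * l) <= K * Cmod (y - x) ^ 2)%R) ->
  is_derive (K := C_AbsRing) (V := C_NormedModule) f x l.
Proof.
  intros HK. split.
  { apply (is_linear_scal_l (K := C_AbsRing) (V := C_NormedModule)). }
  intros z Hz eps.
  apply (is_filter_lim_locally_unique (V := AbsRing_NormedModule C_AbsRing)) in Hz.
  subst z.
  assert (Hd : (0 < Rmin 1 (eps / (Rabs K + 1)))%R).
  { apply Rmin_glb_lt; [lra|]. apply Rdiv_lt_0_compat; [apply cond_pos|].
    pose proof (Rabs_pos K). lra. }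
  exists (mkposreal _ Hd). intros y Hy.
  change (Cmod (y - x) < Rmin 1 (eps / (Rabs K + 1)))%R in Hy.
  change (Cmod (f y - f x - (y - x) * l) <= eps * Cmod (y - x))%R.
  pose proof (Rmin_l 1 (eps / (Rabs K + 1))) as M1.
  pose proof (Rmin_r 1 (eps / (Rabs K + 1))) as M2.
  eapply Rle_trans; [apply HK; lra|].
  replace (K * Cmod (y - x) ^ 2)%R with (K * Cmod (y - x) * Cmod (y - x))%R by ring.
  apply Rmult_le_compat_r; [apply Cmod_ge_0|].
  pose proof (Rabs_pos K) as KP. pose proof (Cmod_ge_0 (y - x)) as CP.
  apply Rle_trans with ((Rabs K + 1) * Cmod (y - x))%R.
  { apply Rmult_le_compat_r; [exact CP|]. pose proof (Rle_abs K). lra. }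
  apply Rle_trans with ((Rabs K + 1) * (eps / (Rabs K + 1)))%R.
  - apply Rmult_le_compat_l; lra.
  - right. field. lra.
Qed.

Lemma polynomial_quadratic_bound (c : nat -> C) (n : nat) :
  exists K, forall w, (Cmod w <= 1)%R ->
    (Cmod (sum_n (G := C_NormedModule) (fun j => w ^ j * c j)%C (S n)
           - c 0%nat - w * c 1%nat) <= K * Cmod w ^ 2)%R.
Proof.
  induction n as [|n [K IH]].
  - exists 0%R. intros w _. rewrite sum_Sn, sum_O. change plus with Cplus.
    match goal with |- (Cmod ?e <= _)%R => assert (E : @eq C e 0) by (simpl; ring) end.
    rewrite E, Cmod_0. lra.
  - exists (K + Cmod (c (S (S n))))%R. intros w Hw. specialize (IH w Hw).
    rewrite sum_Sn. change plus with Cplus.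
    match goal with |- (Cmod (?s + ?t - ?a - ?b) <= _)%R =>
      assert (E : @eq C (s + t - a - b) ((s - a - b) + t)) by ring end.
    rewrite E. eapply Rle_trans; [apply Cmod_triangle|].
    rewrite Rmult_plus_distr_r. apply Rplus_le_compat; [exact IH|].
    rewrite Cmod_mult, Cmod_pow, Rmult_comm. apply Rmult_le_compat_l; [apply Cmod_ge_0|].
    change (S (S n)) with (2 + n)%nat. rewrite pow_add.
    rewrite <- (Rmult_1_r (Cmod w ^ 2)) at 2.
    apply Rmult_le_compat_l; [apply pow2_ge_0|].
    rewrite <- (pow1 n). apply pow_incr. split; [apply Cmod_ge_0|exact Hw].
Qed.

(** * Forward differences of the Bell based Apostol type polynomials *)

(** The [j]-th forward difference, with step [1], in the variable [x1]. *)
Fixpoint fdiff (j : nat) (A : C -> C) (x : C) : C :=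
  match j with
  | O => A x
  | S j => fdiff j A (x + 1) - fdiff j A x
  end.

Lemma bell_apostol_gf_shift_x1 (alpha : nat) (lambda eta delta x1 x2 t : C) :
  bell_apostol_gf alpha lambda eta delta (x1 + 1) x2 t
  = bell_apostol_gf alpha lambda eta delta x1 x2 t * Cexp t.
Proof.
  unfold bell_apostol_gf. rewrite <- Cmult_assoc, <- Cexp_plus.
  do 2 f_equal. ring.
Qed.

Lemma bell_apostol_gf_shift_x2 (alpha : nat) (lambda eta delta x1 x2 w t : C) :
  bell_apostol_gf alpha lambda eta delta x1 (x2 + w) t
  = bell_apostol_gf alpha lambda eta delta x1 x2 t * Cexp (w * (Cexp t - 1)).
Proof.
  unfold bell_apostol_gf. rewrite <- Cmult_assoc, <- Cexp_plus.
  do 2 f_equal. ring.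
Qed.

(** Each forward difference in [x1] multiplies the generating function by
    [exp t - 1]. *)
Lemma is_series_fdiff (alpha : nat) (lambda eta delta : C)
    (F : nat -> C -> C -> C) (HF : is_bell_apostol alpha lambda eta delta F)
    (j : nat) : forall (x1 x2 t : C),
  t <> 0 -> Rbar_lt (Cmod t) (apostol_radius lambda) ->
  is_series (K := C_AbsRing) (V := C_NormedModule)
    (fun n => fdiff j (fun x => F n x x2) x1 / INR (fact n) * t ^ n)
    (bell_apostol_gf alpha lambda eta delta x1 x2 t
     * (Cexp t - 1) ^ j).
Proof.
  set (G := bell_apostol_gf alpha lambda eta delta).
  induction j as [|j IH]; intros x1 x2 t Ht Hr.
  - replace (G x1 x2 t * (Cexp t - 1) ^ 0) with (G x1 x2 t) by (simpl; ring).
    apply is_series_ext with (2 := HF x1 x2 t Ht Hr).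
    intros n. simpl fdiff. refine (_ : @eq C _ _). field. apply INR_fact_C_neq_0.
  - pose proof (is_series_minus (K := C_AbsRing) (V := C_NormedModule) _ _ _ _
      (IH (x1 + 1) x2 t Ht Hr) (IH x1 x2 t Ht Hr)) as H.
    replace (G x1 x2 t * (Cexp t - 1) ^ S j)
      with (G (x1 + 1) x2 t * (Cexp t - 1) ^ j - G x1 x2 t * (Cexp t - 1) ^ j).
    2: { unfold G. rewrite bell_apostol_gf_shift_x1. simpl. ring. }
    apply is_series_ext with (2 := H).
    intros n. simpl fdiff. change plus with Cplus. change opp with Copp.
    refine (_ : @eq C _ _). field. apply INR_fact_C_neq_0.
Qed.

(** Coefficients of the generating function at [(x1, x2 + w)] once
    [exp (w * (exp t - 1))] is replaced by its Taylor polynomial. *)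
Lemma is_series_taylor (alpha : nat) (lambda eta delta : C)
    (F : nat -> C -> C -> C) (HF : is_bell_apostol alpha lambda eta delta F)
    (x1 x2 w t : C) (m : nat) :
  t <> 0 -> Rbar_lt (Cmod t) (apostol_radius lambda) ->
  is_series (K := C_AbsRing) (V := C_NormedModule)
    (fun n => sum_n (G := C_NormedModule)
       (fun j => w ^ j * (fdiff j (fun x => F n x x2) x1 / INR (fact j))) m
       / INR (fact n) * t ^ n)
    (bell_apostol_gf alpha lambda eta delta x1 x2 t
     * exp_taylor (w * (Cexp t - 1)) m).
Proof.
  set (G := bell_apostol_gf alpha lambda eta delta).
  intros Ht Hr.
  assert (Hterm : forall j, is_series (K := C_AbsRing) (V := C_NormedModule)
    (fun n => w ^ j * (fdiff j (fun x => F n x x2) x1 / INR (fact j))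
       / INR (fact n) * t ^ n)
    (G x1 x2 t * ((w * (Cexp t - 1)) ^ j / INR (fact j)))).
  { intros j.
    pose proof (is_series_scal (K := C_AbsRing) (V := C_NormedModule)
      (w ^ j / INR (fact j)) _ _ (is_series_fdiff _ _ _ _ _ HF j x1 x2 t Ht Hr)) as H.
    replace (G x1 x2 t * ((w * (Cexp t - 1)) ^ j / INR (fact j)))
      with (w ^ j / INR (fact j) * (G x1 x2 t * (Cexp t - 1) ^ j)).
    2: { rewrite Cpow_mult_l. field. apply INR_fact_C_neq_0. }
    apply is_series_ext with (2 := H).
    intros n. change scal with Cmult. refine (_ : @eq C _ _). field.
    split; apply INR_fact_C_neq_0. }
  induction m as [|m IH].
  - unfold exp_taylor. rewrite sum_O.
    apply is_series_ext with (2 := Hterm 0%nat). intros n. now rewrite sum_O.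
  - rewrite exp_taylor_S, Cmult_plus_distr_l.
    pose proof (is_series_plus (K := C_AbsRing) (V := C_NormedModule) _ _ _ _
      IH (Hterm (S m))) as H.
    apply is_series_ext with (2 := H).
    intros n. rewrite sum_Sn. change plus with Cplus. refine (_ : @eq C _ _). field.
    split; apply INR_fact_C_neq_0.
Qed.

(** [F n x1] is a polynomial in its second variable, with Taylor coefficients
    at [x2] given by the forward differences in the first variable.  The sum is
    taken up to [n + 1], so that the linear term is present for every [n]. *)
Lemma bell_apostol_taylor (alpha : nat) (lambda eta delta : C)
    (F : nat -> C -> C -> C) (HF : is_bell_apostol alpha lambda eta delta F)
    (n : nat) (x1 x2 w : C) :
  F n x1 (x2 + w)
  = sum_n (G := C_NormedModule)
      (fun j => w ^ j * (fdiff j (fun x => F n x x2) x1 / INR (fact j))) (S n).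
Proof.
  set (G := bell_apostol_gf alpha lambda eta delta).
  set (T := fun k => sum_n (G := C_NormedModule)
    (fun j => w ^ j * (fdiff j (fun x => F k x x2) x1 / INR (fact j))) (S n)).
  change (F n x1 (x2 + w) = T n).
  assert (Hrad : exists r, (0 < r)%R /\ forall t, (0 < t < r)%R ->
    RtoC t <> 0 /\ Rbar_lt (Cmod (RtoC t)) (apostol_radius lambda)).
  { assert (Hr : exists r, (0 < r)%R /\ Rbar_le r (apostol_radius lambda)).
    { pose proof (apostol_radius_pos lambda) as Hp.
      destruct (apostol_radius lambda) as [r| |].
      - exists r. split; [exact Hp|apply Rbar_le_refl].
      - exists 1%R. split; [lra|exact I].
      - destruct Hp. }
    destruct Hr as [r [Hr Hle]]. exists r. split; [exact Hr|].
    intros t Ht. split; [intros E; apply RtoC_inj in E; lra|].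
    rewrite Cmod_R, Rabs_pos_eq by lra.
    apply Rbar_lt_le_trans with (2 := Hle). simpl. lra. }
  destruct Hrad as [r [Hr Hin]].
  (* The generating function at [(x1, x2)] is bounded near [0], as the case [j = 0] of
     [is_series_fdiff]. *)
  destruct (power_series_bounded
    (fun k => fdiff 0 (fun x => F k x x2) x1 / INR (fact k))
    (fun t => G x1 x2 (RtoC t) * (Cexp (RtoC t) - 1) ^ 0) r Hr) as [K [d [Hd HK]]].
  { intros t Ht. destruct (Hin t Ht) as [Ht0 Htr].
    exact (is_series_fdiff _ _ _ _ _ HF 0 x1 x2 _ Ht0 Htr). }
  destruct (Cexp_taylor_remainder w (S n)) as [M [HM Hrem]].
  set (r' := Rmin r (Rmin d (/ 2))).
  assert (Hr' : (0 < r')%R) by (unfold r'; repeat apply Rmin_glb_lt; lra).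
  assert (Hle : (r' <= r /\ r' <= d /\ r' <= / 2)%R).
  { unfold r'. pose proof (Rmin_l r (Rmin d (/ 2))).
    pose proof (Rmin_r r (Rmin d (/ 2))).
    pose proof (Rmin_l d (/ 2)). pose proof (Rmin_r d (/ 2)). lra. }
  clearbody r'.
  assert (Hzero : F n x1 (x2 + w) / INR (fact n) - T n / INR (fact n) = 0).
  { apply (power_series_coef_vanish (S (S n))
      (fun k => F k x1 (x2 + w) / INR (fact k) - T k / INR (fact k))
      (fun t => G x1 (x2 + w) (RtoC t)
                - G x1 x2 (RtoC t) * exp_taylor (w * (Cexp (RtoC t) - 1)) (S n))
      r' (Rabs K * (M * 2 ^ S (S n)))); [exact Hr'| | |lia].
    - intros t Ht. destruct (Hin t ltac:(lra)) as [Ht0 Htr].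
      pose proof (is_series_minus (K := C_AbsRing) (V := C_NormedModule) _ _ _ _
        (HF x1 (x2 + w) _ Ht0 Htr)
        (is_series_taylor _ _ _ _ _ HF x1 x2 w _ (S n) Ht0 Htr)) as H.
      apply is_series_ext with (2 := H).
      intros k. fold (T k). change plus with Cplus. change opp with Copp.
      refine (_ : @eq C _ _). field. apply INR_fact_C_neq_0.
    - intros t Ht. specialize (HK t ltac:(lra)).
      simpl Cpow in HK. rewrite Cmult_1_r in HK.
      (* [exp t <= 1 / (1 - t) <= 1 + 2 t] for [0 <= t <= 1 / 2]. *)
      assert (Hs : (0 <= exp t - 1 <= 2 * t)%R).
      { split; [pose proof (exp_ineq1_le t); lra|].
        pose proof (exp_ineq1_le (- t)) as H1. pose proof (exp_pos t) as H2.
        assert (H3 : (exp t * (1 - t) <= 1)%R).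
        { apply Rle_trans with (exp t * exp (- t))%R.
          - apply Rmult_le_compat_l; lra.
          - rewrite <- exp_plus, Rplus_opp_r, exp_0. lra. }
        nra. }
      unfold G. rewrite bell_apostol_gf_shift_x2. fold G.
      rewrite Cexp_RtoC, <- RtoC_minus.
      match goal with |- (Cmod (?a * ?b - ?a * ?c) <= _)%R =>
        replace (a * b - a * c) with (a * (b - c)) by ring end.
      rewrite Cmod_mult, Rmult_assoc.
      apply Rmult_le_compat; try apply Cmod_ge_0.
      + eapply Rle_trans; [exact HK|apply Rle_abs].
      + eapply Rle_trans; [apply Hrem; rewrite Rabs_pos_eq; lra|].
        rewrite Rmult_assoc, <- Rpow_mult_distr, Rabs_pos_eq by lra.
        apply Rmult_le_compat_l; [exact HM|]. apply pow_incr. exact Hs. }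
  replace (F n x1 (x2 + w))
    with ((F n x1 (x2 + w) / INR (fact n) - T n / INR (fact n)) * INR (fact n) + T n)
    by (field; apply INR_fact_C_neq_0).
  rewrite Hzero. ring.
Qed.

Theorem theorem4p2 :
  forall (alpha : nat) (lambda eta delta : C) (F : nat -> C -> C -> C),
    is_bell_apostol alpha lambda eta delta F ->
    forall n : nat, (1 <= n)%nat ->
    forall x1 x2 : C,
      is_derive (K := C_AbsRing) (V := C_NormedModule)
        (fun y : C => F n x1 y) x2 (F n (x1 + 1) x2 - F n x1 x2).
Proof.
  intros alpha lambda eta delta F HF n _ x1 x2.
  set (c := fun j => fdiff j (fun x => F n x x2) x1 / INR (fact j)).
  destruct (polynomial_quadratic_bound c n) as [K HK].
  apply is_derive_of_quadratic_bound with K.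
  intros y Hy. specialize (HK (y - x2) Hy). unfold c in HK at 1.
  rewrite <- (bell_apostol_taylor _ _ _ _ _ HF) in HK.
  replace (x2 + (y - x2)) with y in HK by ring.
  replace (c 0%nat) with (F n x1 x2) in HK.
  2: { unfold c; simpl. field. }
  replace (c 1%nat) with (F n (x1 + 1) x2 - F n x1 x2) in HK.
  2: { unfold c; simpl. field. }
  exact HK.
Qed.
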